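(* Let $p\geq 5$ be a prime number and $n$ a positive integer. Then $$\binom{np-1}{p-1}_{2}\equiv \begin{cases} 1+npq_{3} \pmod{p^{2}} & \text{if } p\equiv 1 \pmod 3,\\ -1-npq_{3} \pmod{p^{2}} & \text{if } p\equiv 2 \pmod 3,\end{cases}$$ and $$\binom{np-1}{\frac{p-1}{2}}_{2}\equiv \begin{cases} 1+np\left(2q_{2}+\tfrac{1}{2}q_{3}\right) \pmod{p^{2}} & \text{if } p\equiv 1 \pmod 6,\\ -\tfrac{1}{2}npq_{3} \pmod{p^{2}} & \text{if } p\equiv 5 \pmod 6.\end{cases}$$
   Context: For a nonnegative integer $m$, the trinomial coefficients $\binom{m}{k}_2$ are defined by $(1+x+x^2)^m=\sum_{k=0}^{2m}\binom{m}{k}_2x^k$. For a prime $p$ and an integer $a$ not divisible by $p$, the Fermat quotient is $q_a=(a^{p-1}-1)/p$. Congruences involving rational numbers are understood for rationals whose denominators are coprime to $p$ (i.e. in the ring of $p$-integral rationals). *)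

(* Defs.v *)
From HB Require Import structures.
From mathcomp Require Import all_boot all_order all_algebra.
Set Implicit Arguments. Unset Strict Implicit. Unset Printing Implicit Defensive.
Import Order.TTheory GRing.Theory Num.Theory.
Local Open Scope ring_scope.

Definition trinomial (m k : nat) : int :=
  ((1 + 'X + 'X^2) ^+ m : {poly int})`_k.

(* An integer when p is prime and p does not divide a, here viewed in rat. *)
Definition fermat_quotient (p : nat) (a : int) : rat :=
  ((a ^+ p.-1 - 1)%:~R) / p%:R.

Definition p_integral (p : nat) (x : rat) : bool := coprime p `|denq x|.

Definition rat_congr (p m : nat) (x y : rat) : Prop :=
  [/\ p_integral p x, p_integral p y &
      exists2 z : rat, p_integral p z & x - y = m%:R * z].

(* Main.v *)
Require Import Defs.
From mathcomp Require Import all_boot all_order all_algebra.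
From mathcomp Require Import zify ring.
Import GRing.Theory.
Local Open Scope ring_scope.

(* Put [F = 1 + X + X^2]. Comparing coefficients in [F (F^m)' = m F' F^m] for
   [m = np] shows that [F^(np) = 1 + np log F] modulo [p^2] and [X^p], where the
   coefficient of [X^i] in [log F] is [-2 / i] if [3 | i] and [1 / i] otherwise.
   Dividing by [F], i.e. multiplying by [(1 - X) / (1 - X^3)], the coefficient
   of [X^k] in [F^(np-1)] becomes a constant plus [np] times a sum of [w(j) / j]
   over [0 < j < p], where [w] has period 6. By Lerch's formula the Fermat
   quotients of 2, 3 and 6 are sums of the same kind modulo [p], and such a sum
   vanishes when [w(p - j) = w(j)]. With [q_6 = q_2 + q_3], each congruence
   reduces to checking this symmetry on the six residue classes modulo 6. *)

(** * Weighted reciprocal sums in characteristic [p] *)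

(** Such sums matter only modulo [p]; values in a field of characteristic [p] turn the congruences
    into equalities. *)
Definition recip_sum (K : fieldType) (p : nat) (w : nat -> int) : K :=
  \sum_(1 <= j < p) (w j)%:~R / j%:R.

Lemma pchar_natr_neq0 (K : fieldType) (p j : nat) : p \in [pchar K] ->
  (0 < j < p)%N -> j%:R != 0 :> K.
Proof.
move=> pK /andP[j0 jp]; rewrite -(dvdn_pcharf pK); apply/negP => /dvdn_leq.
by move=> /(_ j0); rewrite leqNgt jp.
Qed.

Lemma recip_sum_scale (K : fieldType) (p : nat) (c : int) (w : nat -> int) :
  recip_sum K p (fun j => c * w j) = c%:~R * recip_sum K p w.
Proof.
by rewrite /recip_sum big_distrr /=; apply: eq_bigr => j _; rewrite intrM mulrA.
Qed.

Lemma recip_sumD (K : fieldType) (p : nat) (w1 w2 : nat -> int) :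
  recip_sum K p (fun j => w1 j + w2 j) = recip_sum K p w1 + recip_sum K p w2.
Proof.
by rewrite /recip_sum -big_split; apply: eq_bigr => j _; rewrite intrD mulrDl.
Qed.

Lemma eq_recip_sum (K : fieldType) (p : nat) (w1 w2 : nat -> int) :
  (forall j, (0 < j < p)%N -> w1 j = w2 j) -> recip_sum K p w1 = recip_sum K p w2.
Proof. by move=> w12; apply: eq_big_nat => j jp; rewrite w12. Qed.

(** The substitution [j -> p - j] turns [1 / j] into [- 1 / j], so the sum is its own negative, and
    2 is invertible in [K]. *)
Lemma recip_sum_sym (K : fieldType) (p : nat) (w : nat -> int) :
  p \in [pchar K] -> odd p ->
  (forall j, (0 < j < p)%N -> w (p - j)%N = w j) -> recip_sum K p w = 0.
Proof.
move=> pK p_odd wsym.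
have p2 : (2 < p)%N by have := prime_gt1 (pcharf_prime pK); lia.
have E : recip_sum K p w = - recip_sum K p w.
  rewrite {1}/recip_sum big_nat_rev -sumrN; apply: eq_big_nat => j jp /=.
  rewrite (_ : (1 + p - j.+1 = p - j)%N); last by lia.
  rewrite wsym // natrB; last by lia.
  by rewrite (pcharf0 pK) sub0r invrN mulrN.
apply/eqP; have /eqP : (2%:R : K) * recip_sum K p w = 0.
  by rewrite mulr_natl mulr2n {1}E addNr.
by rewrite mulf_eq0 (negbTE (pchar_natr_neq0 K p 2 pK _)).
Qed.

(** * Lerch's formula for Fermat quotients *)

(** First-order expansion in [p]: the coefficient of [p] is identified only in [K], as the product
    times a logarithmic derivative. *)
Lemma prod_add_multiple (K : fieldType) (p : nat) (s : seq nat) (y : nat -> int) :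
  p \in [pchar K] -> (forall j, j \in s -> j%:R != 0 :> K) ->
  exists2 E : int, \prod_(j <- s) (j%:Z + p%:Z * y j) =
      \prod_(j <- s) j%:Z + p%:Z * E &
    E%:~R = (\prod_(j <- s) j%:Z)%:~R * \sum_(j <- s) (y j)%:~R / j%:R :> K.
Proof.
move=> pK; elim: s => [|x s IHs] s0.
  by exists 0; rewrite !big_nil; [ring | rewrite mulr0].
have [j js|E eqE imE] := IHs; first by apply: s0; rewrite inE js orbT.
have x0 : x%:R != 0 :> K by apply: s0; rewrite mem_head.
exists (x%:Z * E + y x * (\prod_(j <- s) j%:Z) + p%:Z * y x * E).
  by rewrite !big_cons eqE; ring.
rewrite !big_cons !intrD !intrM imE.
have -> : p%:Z%:~R = 0 :> K by exact: (pcharf0 pK).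
set P := (\prod_(j <- s) _)%:~R; set S := \sum_(j <- s) _.
have -> : x%:Z%:~R = x%:R :> K by [].
by field.
Qed.

(* [r + p * ((r * e) %% a)] is the multiple of [a] in [(0, a p)] congruent to
   [r] modulo [p], so the product of these integers over [0 < r < p] is
   [a ^ (p - 1) * (p - 1)!]; expand it modulo [p ^ 2]. *)
Lemma lerch_fermat_quotient (K : fieldType) (p a e : nat) :
  p \in [pchar K] -> (0 < a)%N -> (a %| p * e + 1)%N ->
  exists2 Q : int, a%:Z ^+ p.-1 = 1 + p%:Z * Q &
    Q%:~R = recip_sum K p (fun j => ((j * e) %% a)%N%:Z).
Proof.
move=> pK a0 ae; have p_prime := pcharf_prime pK; have p0 := prime_gt0 p_prime.
pose m r := ((r * e) %% a)%N; pose f r := ((r + p * m r) %/ a)%N.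
have fa r : (f r * a = r + p * m r)%N.
  apply: divnK; have -> : (a %| r + p * m r)%N = (a %| r * (p * e + 1))%N.
    rewrite /dvdn -modnDmr modnMmr modnDmr; congr (_ %% _ == _)%N; lia.
  exact: dvdn_mull.
have ma r : (m r < a)%N by rewrite ltn_mod.
have s_neq0 j : j \in index_iota 1 p -> j%:R != 0 :> K.
  by rewrite mem_index_iota; apply: pchar_natr_neq0.
(* [r] is the residue of [f r * a] modulo [p], so [f] is injective; [0 < r + p * m r < a * p] keeps
   [f r] in [(0, p)]. *)
have f_perm : perm_eq (map f (index_iota 1 p)) (index_iota 1 p).
  have uf : uniq (map f (index_iota 1 p)).
    rewrite map_inj_in_uniq ?iota_uniq // => r s; rewrite !mem_index_iota.
    move=> rp sp frs; have := fa r; rewrite frs fa => rs.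
    have := congr1 (modn^~ p) rs; rewrite /= ![(_ + p * _)%N]addnC ![(p * _)%N]mulnC.
    rewrite !modnMDl !modn_small //; lia.
  apply: uniq_perm => //; first exact: iota_uniq.
  apply: (uniq_min_size uf _ _).2; last by rewrite size_map.
  move=> _ /mapP[r + ->]; rewrite !mem_index_iota => rp.
  have := fa r; have := ma r; nia.
have [E eqE imE] :=
  prod_add_multiple K p (index_iota 1 p) (fun r => (m r)%:Z) pK s_neq0.
set P := \prod_(j <- _) j%:Z in eqE imE.
have P0 : P%:~R != 0 :> K.
  by rewrite /P rmorph_prod prodf_seq_neq0; apply/allP => j /s_neq0.
have PE : P * a%:Z ^+ p.-1 = P + p%:Z * E.
  rewrite -eqE /P -(perm_big _ f_perm) big_map -subn1 -prodr_const_nat -big_split.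
  apply: eq_bigr => r _ /=; have := fa r; lia.
(* Fermat's little theorem for [a], from [PE] and the invertibility of [P] in [K]. *)
have [Q QE] : exists Q : int, a%:Z ^+ p.-1 - 1 = Q * p%:Z.
  apply/dvdzP; rewrite (dvdz_pcharf pK).
  have : (P * (a%:Z ^+ p.-1 - 1))%:~R == 0 :> K.
    by rewrite -(dvdz_pcharf pK) mulrBr PE mulr1 addrAC subrr add0r dvdz_mulr.
  by rewrite intrM mulf_eq0 (negbTE P0).
have QE' : a%:Z ^+ p.-1 = 1 + p%:Z * Q by rewrite mulrC -QE addrC subrK.
exists Q => //; apply: (mulfI P0); rewrite -imE -intrM; congr (_%:~R).
apply: (@mulfI _ p%:Z); first by lia.
by move: PE; rewrite QE'; lia.
Qed.

(** * Trinomial coefficients modulo [p ^ 2] *)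

Lemma coef_mul_trinomial (q : {poly int}) :
  [/\ ((1 + 'X + 'X^2) * q)`_0 = q`_0, ((1 + 'X + 'X^2) * q)`_1 = q`_1 + q`_0 &
    forall k, ((1 + 'X + 'X^2) * q)`_k.+2 = q`_k.+2 + q`_k.+1 + q`_k].
Proof.
by split=> [||k]; rewrite !mulrDl mul1r !coefD coefXM coefXnM /= ?addr0 ?subn2.
Qed.

Lemma trinomialS (m : nat) :
  [/\ trinomial m.+1 0 = trinomial m 0,
    trinomial m.+1 1 = trinomial m 1 + trinomial m 0 &
    forall k, trinomial m.+1 k.+2 =
      trinomial m k.+2 + trinomial m k.+1 + trinomial m k].
Proof. by rewrite /trinomial exprS; apply: coef_mul_trinomial. Qed.

Lemma trinomial0 (m : nat) : trinomial m 0 = 1.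
Proof.
elim: m => [|m IHm]; first by rewrite /trinomial expr0 coef1.
by have [-> _ _] := trinomialS m.
Qed.

(* Compare coefficients in [F * (F ^ m)' = m F' * F ^ m]. *)
Lemma trinomial_rec (m : nat) :
  [/\ trinomial m 1 = m%:Z,
    2 * trinomial m 2 + trinomial m 1 = m%:Z * (trinomial m 1 + 2) &
    forall k, k.+3%:Z * trinomial m k.+3 + k.+2%:Z * trinomial m k.+2 +
        k.+1%:Z * trinomial m k.+1 =
      m%:Z * (trinomial m k.+2 + 2 * trinomial m k.+1)].
Proof.
have E : (1 + 'X + 'X^2) * ((1 + 'X + 'X^2) ^+ m)^`() =
    m%:Z *: ((1 + 'X + 'X^2) ^+ m + 2 *: ('X * (1 + 'X + 'X^2) ^+ m)) :> {poly int}.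
  case: m => [|m]; first by rewrite expr0 derivC mulr0 scale0r.
  rewrite deriv_exp !derivE -[Posz m.+1]natz -!mul_polyC !polyC_natr /=.
  rewrite [_ ^+ m.+1]exprS -mulr_natr; ring.
have [E0 E1 E2] := coef_mul_trinomial ((1 + 'X + 'X^2) ^+ m)^`().
have co i : (((1 + 'X + 'X^2) ^+ m)^`())`_i = i.+1%:Z * trinomial m i.+1.
  by rewrite coef_deriv -mulr_natl natz.
move: E0 E1 E2; rewrite E !co.
rewrite !(coefZ, coefD, coefXM) /= -!/(trinomial _ _) trinomial0 => E0 E1 E2.
split=> [||k]; [lia | lia |].
have := E2 k; rewrite !(coefZ, coefD, coefXM) !co /= -!/(trinomial _ _) => ->.
by [].
Qed.

(* The coefficients of [1 / F = (1 - X) / (1 - X ^ 3)]. *)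
Definition inv_coef (k : nat) : int :=
  if (k %% 3 == 0)%N then 1 else if (k %% 3 == 1)%N then -1 else 0.

(* [log F] has the coefficients [log_coef i / i]. *)
Definition log_coef (i : nat) : int := if (3 %| i)%N then -2 else 1.

Lemma inv_coefD3 (k : nat) : inv_coef (k + 3) = inv_coef k.
Proof. by rewrite /inv_coef modnDr. Qed.

Lemma trinomial_pred (m k : nat) :
  trinomial m k = \sum_(i < k.+1) inv_coef (k - i) * trinomial m.+1 i.
Proof.
have [t0 t1 t2] := trinomialS m; elim/ltn_ind: k => -[|[|[|k]]] IHk.
- by rewrite big_ord_recl big_ord0 t0 /= addr0 mul1r.
- rewrite !big_ord_recl big_ord0 t0 /= /bump /= t1 /inv_coef /=; ring.
- rewrite !big_ord_recl big_ord0 t0 /= /bump /= t1 t2 /inv_coef /=; ring.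
(* By period 3 the terms [i <= k] sum to [trinomial m k]; the last three give [trinomial m.+1 k.+3 -
   trinomial m.+1 k.+2], which is [trinomial m k.+3 - trinomial m k]. *)
rewrite 3!big_ord_recr /= subnn subSnn (_ : (k.+3 - k.+1 = 2)%N); last by lia.
rewrite [X in X + _ + _ + _](_ : _ = trinomial m k).
  rewrite !t2 /inv_coef /=; ring.
rewrite IHk; last by lia.
apply: eq_bigr => i _; rewrite -(inv_coefD3 (k - i)); congr (inv_coef _ * _).
have := ltn_ord i; lia.
Qed.

(** With [m = n * p] the right side of the recurrence has a second factor [p], so modulo [p] three
    consecutive [i * v] sum to 0, as do three consecutive values of [log_coef]. *)
Lemma trinomial_coef_mod (K : fieldType) (p n i : nat) :
  p \in [pchar K] -> (2 < p)%N -> (0 < i < p)%N ->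
  exists2 v : int, trinomial (n * p) i = p%:Z * v &
    i%:R * v%:~R = n%:R * (log_coef i)%:~R :> K.
Proof.
move=> pK p2; have [u1 u2 u3] := trinomial_rec (n * p).
have pK0 : p%:Z%:~R = 0 :> K by exact: (pcharf0 pK).
have div_step j (x : int) : (0 < j < p)%N -> j%:Z * trinomial (n * p) j = p%:Z * x ->
    exists2 v : int, trinomial (n * p) j = p%:Z * v & j%:Z * v = x.
  move=> jp jx; have [v uv] : exists v, trinomial (n * p) j = v * p%:Z.
    apply/dvdzP; rewrite (dvdz_pcharf pK).
    have : (j%:Z * trinomial (n * p) j)%:~R == 0 :> K.
      by rewrite jx intrM pK0 mul0r.
    by rewrite intrM mulf_eq0 (negbTE (pchar_natr_neq0 K p j pK jp)).
  exists v; first by rewrite mulrC.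
  apply: (@mulfI _ p%:Z); first by lia.
  by rewrite -jx uv; ring.
elim/ltn_ind: i => -[|[|[|i]]] IHi ip //.
- exists n%:Z; first by rewrite u1; lia.
  by rewrite mul1r mulr1.
- have [|v uv v2] := div_step 2%N (n%:Z * (n%:Z * p%:Z + 1)) ip.
    move: u2; rewrite u1; lia.
  exists v => //; have := congr1 (fun x : int => x%:~R : K) v2.
  rewrite !intrM intrD intrM pK0 mulr0 add0r !mulr1 => <-; by rewrite mulrC.
have [||v1 uv1 v1E] := IHi i.+1; [lia | lia |].
have [||v2 uv2 v2E] := IHi i.+2; [lia | lia |].
have [|v uv vE] := div_step i.+3
  (p%:Z * (n%:Z * (v2 + 2 * v1)) - i.+2%:Z * v2 - i.+1%:Z * v1) ip.
  by have := u3 i; rewrite uv1 uv2; lia.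
exists v => //; have := congr1 (fun x : int => x%:~R : K) vE.
rewrite !(intrB, intrM) pK0 mul0r sub0r.
rewrite [_ * v2%:~R]v2E [_ * v1%:~R]v1E => ->.
rewrite -opprD -mulrDr -mulrN; congr (_ * _).
rewrite -intrD -rmorphN; congr (_%:~R); rewrite /log_coef; do 3!case: ifP; lia.
Qed.

(** The term [i = 0] of [trinomial_pred] is [inv_coef k]. The index [k + 2 * i] is [k - i] modulo 3,
    free of truncated subtraction. *)
Lemma trinomial_pred_mod (K : fieldType) (p n k : nat) :
  p \in [pchar K] -> (2 < p)%N -> (0 < n)%N -> (k < p)%N ->
  exists2 b : int, trinomial (n * p - 1) k = inv_coef k + p%:Z * b &
    b%:~R = n%:R *
      \sum_(1 <= i < k.+1) (inv_coef (k + 2 * i) * log_coef i)%:~R / i%:R :> K.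
Proof.
move=> pK p2 n0 kp; pose v i := (trinomial (n * p) i %/ p%:Z)%Z.
have p0 : p%:Z != 0 by lia.
have vE i : (0 < i < p)%N -> trinomial (n * p) i = p%:Z * v i /\
    (v i)%:~R = n%:R * (log_coef i)%:~R / i%:R :> K.
  move=> ip; have [x ux xE] := trinomial_coef_mod K p n i pK p2 ip.
  rewrite /v ux mulKz //; split=> //.
  by rewrite -xE mulrC mulKf // (pchar_natr_neq0 K p i pK).
exists (\sum_(1 <= i < k.+1) inv_coef (k + 2 * i) * v i).
  rewrite trinomial_pred (_ : (n * p - 1).+1 = (n * p)%N); last by nia.
  rewrite -(big_mkord xpredT (fun i => inv_coef (k - i) * trinomial (n * p) i)).
  rewrite big_ltn // trinomial0 subn0 mulr1 big_distrr /=; congr (_ + _).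
  apply: eq_big_nat => i ik; have [|-> _] := vE i; first by lia.
  rewrite mulrCA; congr (_ * (_ * _)); rewrite (_ : (k + 2 * i = i * 3 + (k - i))%N).
    by rewrite /inv_coef modnMDl.
  lia.
rewrite rmorph_sum big_distrr; apply: eq_big_nat => i ik /=.
by have [|_ E] := vE i; [lia | rewrite !intrM E; ring].
Qed.

(** * Half-range sums and the symmetry test modulo 6 *)

(** Since [1 / i = 2 / (2 * i)], the half range becomes the even [j] below [p], which makes the sum
    comparable with Lerch's. *)
Lemma sum_half_recip (K : fieldType) (p : nat) (f : nat -> int) :
  p \in [pchar K] -> odd p ->
  \sum_(1 <= i < (p./2).+1) (f i)%:~R / i%:R =
  recip_sum K p (fun j => if odd j then 0 else 2 * f j./2).
Proof.
move=> pK p_odd; have p2 : (2 < p)%N by have := prime_gt1 (pcharf_prime pK); lia.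
have H k : (k.*2 < p)%N -> \sum_(1 <= i < k.+1) (f i)%:~R / i%:R =
    recip_sum K k.*2.+1 (fun j => if odd j then 0 else 2 * f j./2).
  rewrite /recip_sum; elim: k => [|k IHk] kp; first by rewrite !big_geq.
  rewrite big_nat_recr //= IHk; last by lia.
  rewrite doubleS (big_nat_recr k.*2.+2) // (big_nat_recr k.*2.+1) //=.
  rewrite odd_double /= doubleK mul0r addr0.
  congr (_ + _); rewrite intrM -doubleS -muln2 natrM.
  by rewrite [_ * 2%:R]mulrC -mulf_div divff ?mul1r // (pchar_natr_neq0 K p 2 pK).
by rewrite H; [congr recip_sum; lia | lia].
Qed.

(** Once [p %% 6] is known, the test on [iota 0 6] is a computation; the [+ 6] prevents
    truncation. *)
Lemma recip_sum_mod6 (K : fieldType) (p : nat) (w : nat -> int) :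
  p \in [pchar K] -> odd p -> (forall j, w (j %% 6)%N = w j) ->
  all (fun r => w ((p %% 6 + 6 - r) %% 6)%N == w r) (iota 0 6) ->
  recip_sum K p w = 0.
Proof.
move=> pK p_odd wper /allP wsym; apply: recip_sum_sym => // j jp.
rewrite -[RHS]wper -(eqP (wsym (j %% 6)%N _)); last by rewrite mem_iota ltn_mod.
by rewrite -wper; congr w; lia.
Qed.

(** * From the field [K] to [p]-integral rationals *)

Lemma coprime_denq_half (p : nat) (x : int) : odd p -> p_integral p (x%:~R / 2).
Proof.
move=> p_odd; rewrite /p_integral; set y := x%:~R / 2.
apply: (@coprime_dvdr _ 2); last by rewrite coprimen2.
(* Gauss's lemma applied to [2 * numq y = x * denq y]. *)
have : (denq y %| 2)%Z.
  rewrite -(@Gauss_dvdzr _ (numq y));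
    last by rewrite coprimez_sym; exact: coprime_num_den.
  apply/dvdzP; exists x; apply: (@intr_inj rat).
  have d0 : (denq y)%:~R != 0 :> rat by rewrite intr_eq0 denq_eq0.
  rewrite !intrM -[X in X * _](divfK d0) divq_num_den /y; by field.
by rewrite dvdzE.
Qed.

(** The difference is [p * (2 * b - r) / 2], and [p] divides [2 * b - r] because its image in [K] is
    0. The factor 2 accommodates the halves in the theorem. *)
Lemma rat_congr_half (K : fieldType) (p : nat) (t e b r : int) :
  p \in [pchar K] -> odd p -> t = e + p%:Z * b -> 2 * b%:~R = r%:~R :> K ->
  rat_congr p (p ^ 2) t%:~R (e%:~R + p%:R * r%:~R / 2).
Proof.
move=> pK p_odd -> br.
have /dvdzP[z zE] : (p%:Z %| 2 * b - r)%Z.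
  by rewrite (dvdz_pcharf pK) intrB intrM br subrr.
split.
- rewrite -[X in p_integral _ X](mulfK (_ : 2 != 0 :> rat)) //.
  by rewrite -[2]/(2%:~R) -intrM coprime_denq_half.
- rewrite (_ : _ + _ = (2 * e + p%:Z * r)%:~R / 2) ?coprime_denq_half //.
  by rewrite intrD !intrM; field.
exists (z%:~R / 2); first exact: coprime_denq_half.
have := congr1 (fun x : int => x%:~R : rat) zE.
rewrite intrB !intrM !intrD !intrM natrX => E.
have -> : r%:~R = 2 * b%:~R - z%:~R * p%:R :> rat by rewrite -E; ring.
by field.
Qed.

Lemma fermat_quotientE (p : nat) (a Q : int) : (0 < p)%N ->
  a ^+ p.-1 = 1 + p%:Z * Q -> fermat_quotient p a = Q%:~R.
Proof.
move=> p0 aQ; rewrite /fermat_quotient aQ addrAC subrr add0r intrM mulrC mulKf //.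
by rewrite (intr_eq0 _ p); lia.
Qed.

(** * The periodic weights *)

(** Weights of the sum in [trinomial_pred_mod], with [r] the residue of [k] modulo 3. *)
Definition full_weight (r j : nat) : int := inv_coef (r + 2 * j) * log_coef j.

(** For [j = 2 * i] the index [k + 2 * i] is [k + j], and 3 divides [i] exactly when it divides
    [j]. *)
Definition half_weight (r j : nat) : int :=
  if odd j then 0 else 2 * (inv_coef (r + j) * log_coef j).

Definition lerch_weight (a e j : nat) : int := ((j * e) %% a)%N%:Z.

Lemma inv_coef_mod (k l : nat) : k = l %[mod 3] -> inv_coef k = inv_coef l.
Proof. by rewrite /inv_coef => ->. Qed.

Lemma log_coef_mod6 (j : nat) : log_coef (j %% 6) = log_coef j.
Proof. by rewrite /log_coef /dvdn modn_dvdm. Qed.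

Lemma full_weight_mod6 (r j : nat) : full_weight r (j %% 6) = full_weight r j.
Proof.
by rewrite /full_weight log_coef_mod6; congr (_ * _); apply: inv_coef_mod; lia.
Qed.

Lemma half_weight_mod6 (r j : nat) : half_weight r (j %% 6) = half_weight r j.
Proof.
rewrite /half_weight odd_mod // log_coef_mod6.
by rewrite (inv_coef_mod (r + j %% 6) (r + j)) // -modnDmr modn_dvdm // modnDmr.
Qed.

Lemma lerch_weight_mod6 (a e j : nat) :
  (a %| 6)%N -> lerch_weight a e (j %% 6) = lerch_weight a e j.
Proof. by move=> a6; rewrite /lerch_weight -modnMml modn_dvdm // modnMml. Qed.

Lemma trinomial_full (K : fieldType) (p n : nat) :
  p \in [pchar K] -> (2 < p)%N -> (0 < n)%N ->
  exists2 b : int, trinomial (n * p - 1) (p - 1) = inv_coef (p.-1 %% 3) + p%:Z * b &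
    b%:~R = n%:R * recip_sum K p (full_weight (p.-1 %% 3)).
Proof.
move=> pK p2 n0; have [|b -> bE] := trinomial_pred_mod K p n (p - 1) pK p2 n0.
  by lia.
exists b; rewrite ?bE subn1.
  by rewrite (inv_coef_mod (p.-1 %% 3) p.-1) ?modn_mod.
rewrite prednK; last by lia.
congr (_ * _); apply: eq_bigr => j _; congr (_%:~R / _); congr (_ * _).
by apply: inv_coef_mod; rewrite modnDml.
Qed.

Lemma trinomial_half (K : fieldType) (p n : nat) :
  p \in [pchar K] -> odd p -> (2 < p)%N -> (0 < n)%N ->
  exists2 b : int, trinomial (n * p - 1) ((p - 1) %/ 2) =
      inv_coef (p./2 %% 3) + p%:Z * b &
    b%:~R = n%:R * recip_sum K p (half_weight (p./2 %% 3)).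
Proof.
move=> pK p_odd p2 n0; have -> : ((p - 1) %/ 2 = p./2)%N by lia.
have [|b -> bE] := trinomial_pred_mod K p n p./2 pK p2 n0; first by lia.
exists b; first by rewrite (inv_coef_mod (p./2 %% 3) p./2) ?modn_mod.
rewrite bE (sum_half_recip K p (fun i => inv_coef (p./2 + 2 * i) * log_coef i)) //.
congr (_ * _); apply: eq_recip_sum => j _; rewrite /half_weight.
case: ifPn => // j_even; congr (_ * (_ * _)); first by apply: inv_coef_mod; lia.
by rewrite /log_coef; do 2!case: ifP; lia.
Qed.

(** * The residue classes 1 and 5 modulo 6 *)

Theorem theorem1 (p n : nat) (p_prime : prime p) (p_ge5 : (5 <= p)%N)
    (n_gt0 : (0 < n)%N) :
  let q (a : int) : rat := fermat_quotient p a in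
  let np : rat := (n * p)%:R in
  [/\ (p = 1 %[mod 3])%N ->
        rat_congr p (p ^ 2) (trinomial (n * p - 1) (p - 1))%:~R
          (1 + np * q 3),
      (p = 2 %[mod 3])%N ->
        rat_congr p (p ^ 2) (trinomial (n * p - 1) (p - 1))%:~R
          (- 1 - np * q 3),
      (p = 1 %[mod 6])%N ->
        rat_congr p (p ^ 2) (trinomial (n * p - 1) ((p - 1) %/ 2))%:~R
          (1 + np * (2 * q 2 + 1 / 2 * q 3))
    & (p = 5 %[mod 6])%N ->
        rat_congr p (p ^ 2) (trinomial (n * p - 1) ((p - 1) %/ 2))%:~R
          (- (1 / 2) * np * q 3)].
Proof.
have pK := pchar_Fp p_prime; have pK0 : p%:Z%:~R = 0 :> 'F_p by exact: (pcharf0 pK).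
have p_odd : odd p by case: (even_prime p_prime) => // p2; rewrite p2 in p_ge5.
have p3 : (p %% 3 != 0)%N.
  by rewrite -/(dvdn 3 p) dvdn_prime2 //; lia.
(* For [a] dividing 6, [e a] is [-1 / p] modulo [a]. *)
pose e a := if (p %% 6 == 1)%N then a.-1 else 1%N.
have lerch a : (a == 2) || (a == 3) || (a == 6) -> exists2 Q : int,
    a%:Z ^+ p.-1 = 1 + p%:Z * Q &
    Q%:~R = recip_sum 'F_p p (lerch_weight a (e a)).
  move=> ha; apply: lerch_fermat_quotient => //; first by lia.
  by rewrite /e; case: ifP => p6; case/orP: ha => [/orP[]|] /eqP->; lia.
have [//|Q2 Q2E S2] := lerch 2.
have [//|Q3 Q3E S3] := lerch 3.
have [//|Q6 Q6E S6] := lerch 6.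
(* Multiply the expansions of [2 ^ (p - 1)] and [3 ^ (p - 1)]. *)
have Q6K : Q6%:~R = Q2%:~R + Q3%:~R :> 'F_p.
  have -> : Q6 = Q2 + Q3 + p%:Z * Q2 * Q3.
    apply: (@mulfI _ p%:Z); first by lia.
    move: Q6E; rewrite (_ : 6%:Z = 2%:Z * 3%:Z) // exprMn Q2E Q3E; lia.
  by rewrite !intrD !intrM pK0 !mul0r addr0.
have q2E := fermat_quotientE p 2 Q2 (prime_gt0 p_prime) Q2E.
have q3E := fermat_quotientE p 3 Q3 (prime_gt0 p_prime) Q3E.
have [|b1 T1 B1] := trinomial_full 'F_p p n pK _ n_gt0; first by lia.
have [|b2 T2 B2] := trinomial_half 'F_p p n pK p_odd _ n_gt0; first by lia.
have per a ea j : (a %| 6)%N -> lerch_weight a ea (j %% 6) = lerch_weight a ea j.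
  exact: lerch_weight_mod6.
move=> q np; rewrite /q q2E q3E /np natrM {q np q2E q3E}.
have [p6|p6] : {(p %% 6 = 1)%N} + {(p %% 6 = 5)%N}.
- by case: (p %% 6 =P 1)%N => [|p1]; [left | right; lia].
- have r1 : (p.-1 %% 3 = 0)%N by lia.
  have r2 : (p./2 %% 3 = 0)%N by lia.
  rewrite /e p6 /= in S2 S3 S6; rewrite r1 in T1 B1; rewrite r2 in T2 B2.
  (* The combined weight is the constant -2. *)
  have W1 : recip_sum 'F_p p (full_weight 0) = Q3%:~R.
    have := recip_sum_mod6 'F_p p
      (fun j => full_weight 0 j + -1 * lerch_weight 3 2 j) pK p_odd.
    rewrite p6 recip_sumD recip_sum_scale -S3 => W1.
    apply/eqP; rewrite -subr_eq0 -mulN1r -[-1](rmorphN1 intr) W1 // => j.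
    by rewrite full_weight_mod6 per.
  (* On residues 0 to 5 the combined weight is -8, -8, -4, -6, -6, -4, invariant under [r -> 1 - r]
     modulo 6. *)
  have W2 : 2 * recip_sum 'F_p p (half_weight 0) = Q6%:~R + 3 * Q2%:~R.
    have := recip_sum_mod6 'F_p p (fun j => 2 * half_weight 0 j +
      (-1 * lerch_weight 6 5 j + -3 * lerch_weight 2 1 j)) pK p_odd.
    rewrite p6 !recip_sumD !recip_sum_scale -S2 -S6 => W2.
    apply/eqP; rewrite -subr_eq0 -W2 // => [|j]; first by apply/eqP; ring.
    by rewrite half_weight_mod6 !per.
  split=> h; try (exfalso; lia).
  + have -> : 1 + n%:R * p%:R * Q3%:~R =
      1%:~R + p%:R * (2 * n%:Z * Q3)%:~R / 2 :> rat by rewrite !intrM; field.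
    apply: (rat_congr_half 'F_p) T1 _ => //.
    by rewrite B1 W1 !intrM mulrA.
  + have -> : 1 + n%:R * p%:R * (2 * Q2%:~R + 1 / 2 * Q3%:~R) =
      1%:~R + p%:R * (n%:Z * (4 * Q2 + Q3))%:~R / 2 :> rat.
      by rewrite !(intrM, intrD); field.
    apply: (rat_congr_half 'F_p) T2 _ => //.
    by rewrite B2 mulrCA W2 Q6K !(intrM, intrD); ring.
- have r1 : (p.-1 %% 3 = 1)%N by lia.
  have r2 : (p./2 %% 3 = 2)%N by lia.
  rewrite /e p6 /= in S2 S3 S6; rewrite r1 in T1 B1; rewrite r2 in T2 B2.
  (* Here the combined weight is the constant 2. *)
  have W1 : recip_sum 'F_p p (full_weight 1) = - Q3%:~R.
    have := recip_sum_mod6 'F_p p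
      (fun j => full_weight 1 j + 1 * lerch_weight 3 1 j) pK p_odd.
    rewrite p6 recip_sumD recip_sum_scale -S3 => W1.
    apply/eqP; rewrite -addr_eq0 -[Q3%:~R]mul1r W1 // => j.
    by rewrite full_weight_mod6 per.
  (* The combined weight is 0, 2, -2, -2, 2, 0, invariant under [r -> 5 - r]. *)
  have W2 : 2 * recip_sum 'F_p p (half_weight 2) =
      Q6%:~R - Q2%:~R - 2 * Q3%:~R.
    have := recip_sum_mod6 'F_p p (fun j => 2 * half_weight 2 j +
      (-1 * lerch_weight 6 1 j + (1 * lerch_weight 2 1 j +
      2 * lerch_weight 3 1 j))) pK p_odd.
    rewrite p6 !recip_sumD !recip_sum_scale -S2 -S3 -S6 => W2.
    apply/eqP; rewrite -subr_eq0 -W2 // => [|j]; first by apply/eqP; ring.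
    by rewrite half_weight_mod6 !per.
  split=> h; try (exfalso; lia).
  + have -> : - 1 - n%:R * p%:R * Q3%:~R =
      (-1)%:~R + p%:R * (- 2 * n%:Z * Q3)%:~R / 2 :> rat by rewrite !intrM; field.
    apply: (rat_congr_half 'F_p) T1 _ => //.
    by rewrite B1 W1 !intrM; ring.
  + have -> : - (1 / 2) * (n%:R * p%:R) * Q3%:~R =
      0%:~R + p%:R * (- n%:Z * Q3)%:~R / 2 :> rat.
      by rewrite !(intrM, intrN); field.
    apply: (rat_congr_half 'F_p) T2 _ => //.
    by rewrite B2 mulrCA W2 Q6K !intrM; ring.
Qed.
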